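(* Let $\rho>0$, $\gamma>0$ and symmetric positive semi-definite matrices $P_i\in\mathbb{R}^{n_i\times n_i}$ ($i=1,\dots,N$) satisfy, for some $\epsilon_i>0$, $i=1,\dots,N$, $$P_i\succ \rho\Big(\frac{1}{\epsilon_i}-1\Big)A_i^\top A_i,\quad i=1,2,\ldots,N,\qquad\text{and}\qquad \sum_{i=1}^N \epsilon_i<2-\gamma ,$$ and suppose that $G'_x\succeq 0$. Let $\{\mathbf{u}^k\}$, $\mathbf{u}^k=(\mathbf{x}^k,\lambda^k)$, be the sequence generated by Proximal Jacobian ADMM from any initial point. Then, as $k\to\infty$, $$\|\mathbf{u}^{k}-\mathbf{u}^{k+1}\|_{G'}^2=o(1/k),$$ and, thus, $$\|\mathbf{x}^k-\mathbf{x}^{k+1}\|_{G'_x}^2=o(1/k)\quad\text{and}\quad \|\lambda^k-\lambda^{k+1}\|^2=o(1/k).$$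
   Context: Setting: the problem is $\min \sum_{i=1}^N f_i(\mathbf{x}_i)$ subject to $\sum_{i=1}^N A_i\mathbf{x}_i=c$, with $N\ge 2$, $\mathbf{x}_i\in\mathbb{R}^{n_i}$, $A_i\in\mathbb{R}^{m\times n_i}$, $c\in\mathbb{R}^m$, and $f_i:\mathbb{R}^{n_i}\to(-\infty,+\infty]$ closed proper convex. It is assumed that a saddle point (KKT point) exists, i.e. some $\mathbf{u}^*=(\mathbf{x}_1^*,\dots,\mathbf{x}_N^*,\lambda^* )$ with $\lambda^*\in\mathbb{R}^m$, $A_i^\top\lambda^*\in\partial f_i(\mathbf{x}_i^* )$ for all $i$, and $\sum_{i=1}^N A_i\mathbf{x}_i^*=c$. Notation: $n=\sum_i n_i$, $\mathbf{x}=(\mathbf{x}_1,\dots,\mathbf{x}_N)\in\mathbb{R}^n$, $A=(A_1,\dots,A_N)\in\mathbb{R}^{m\times n}$, $\mathbf{u}=(\mathbf{x},\lambda)\in\mathbb{R}^{n+m}$. $\|\cdot\|$ is the Euclidean norm, $\|\mathbf{z}\|_M^2:=\mathbf{z}^\top M\mathbf{z}$ for symmetric positive semi-definite $M$; $M\succ M'$ (resp. $M\succeq M'$) means $M-M'$ is positive definite (resp. semi-definite). Proximal Jacobian ADMM with parameters $\rho>0$, $\gamma>0$, $P_i\succeq 0$: start from arbitrary $\mathbf{x}_i^0$, $\lambda^0$; for $k=0,1,\dots$, for all $i=1,\dots,N$ (in parallel) $$\mathbf{x}_i^{k+1}=\operatorname*{arg\,min}_{\mathbf{x}_i}\ f_i(\mathbf{x}_i)+\frac{\rho}{2}\Big\|A_i\mathbf{x}_i+\sum_{j\ne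 i}A_j\mathbf{x}_j^k-c-\frac{\lambda^k}{\rho}\Big\|^2+\frac12\|\mathbf{x}_i-\mathbf{x}_i^k\|_{P_i}^2,$$ then $\lambda^{k+1}=\lambda^k-\gamma\rho\big(\sum_{i=1}^N A_i\mathbf{x}_i^{k+1}-c\big)$. Matrices: $G_x:=\operatorname{blockdiag}(P_1+\rho A_1^\top A_1,\dots,P_N+\rho A_N^\top A_N)$, $G'_x:=G_x-\rho A^\top A$, and $G':=\operatorname{blockdiag}\big(G'_x,\frac{1}{\gamma\rho}\mathbf{I}\big)$ with $\mathbf{I}$ the $m\times m$ identity. *)

(* Defs.v *)
From HB Require Import structures.
From mathcomp Require Import all_boot all_order all_algebra.
From mathcomp Require Import all_classical all_reals all_analysis.

Set Implicit Arguments.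
Unset Strict Implicit.
Unset Printing Implicit Defensive.
Import Order.TTheory GRing.Theory Num.Theory.
Import numFieldNormedType.Exports.
Local Open Scope ring_scope.

Section Euclidean.
Context {R : realType}.

(* Column vectors are the elements of R^n. The library norm `|_| on matrices
   is the max norm, so the Euclidean one is defined here. *)
Definition dotv n (u v : 'cV[R]_n) : R := (u^T *m v) 0 0.

Definition enorm n (z : 'cV[R]_n) : R := Num.sqrt (dotv z z).

(* The square ||z||_M^2 = z^T M z of the M-seminorm. *)
Definition sqnormM n (M : 'M[R]_n) (z : 'cV[R]_n) : R := (z^T *m M *m z) 0 0.

Definition psdmx n (M : 'M[R]_n) : Prop :=
  M^T = M /\ forall z : 'cV[R]_n, 0 <= sqnormM M z.

Definition pdmx n (M : 'M[R]_n) : Prop :=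
  M^T = M /\ forall z : 'cV[R]_n, z != 0 -> 0 < sqnormM M z.

End Euclidean.

Section ConvexAnalysis.
Context {R : realType}.
Local Open Scope ereal_scope.

Definition proper_fun T (f : T -> \bar R) : Prop :=
  (forall x, -oo < f x) /\ (exists x, f x < +oo).

(* Meant for f > -oo; at t = 0 and t = 1 it relies on 0 * +oo = 0 in \bar R. *)
Definition convex_efun n (f : 'cV[R]_n -> \bar R) : Prop :=
  forall (x y : 'cV[R]_n) (t : R), (0 <= t <= 1)%R ->
    f (t *: x + (1 - t) *: y)%R <= t%:E * f x + (1 - t)%:E * f y.

(* For a proper function, closed means lower semicontinuous. *)
Definition closed_proper_convex n (f : 'cV[R]_n -> \bar R) : Prop :=
  [/\ lower_semicontinuous f, proper_fun f & convex_efun f].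

(* For a proper f this set is empty wherever f x = +oo. *)
Definition subdifferential n (f : 'cV[R]_n -> \bar R) (x : 'cV[R]_n) :
    set 'cV[R]_n :=
  [set g | forall y, f x + (dotv g (y - x)%R)%:E <= f y]%classic.

Definition argmin T (h : T -> \bar R) : set T :=
  [set x | forall y, h x <= h y]%classic.

End ConvexAnalysis.

Unset Implicit Arguments.

Section ProxJADMM.
Context {R : realType} {N m : nat} {n_ : 'I_N -> nat}.
Context (f : forall i, 'cV[R]_(n_ i) -> \bar R).
Context (A : forall i, 'M[R]_(m, n_ i)) (c : 'cV[R]_m).
Context (rho gamma : R) (P : forall i, 'M[R]_(n_ i)).

Definition is_KKT (x : forall i, 'cV[R]_(n_ i)) (lam : 'cV[R]_m) : Prop :=
  (forall i, subdifferential (f i) (x i) ((A i)^T *m lam)) /\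
  \sum_i A i *m x i = c.

(* The function minimized by block i, from the current iterate (x, lam). *)
Definition block_objective (x : forall i, 'cV[R]_(n_ i)) (lam : 'cV[R]_m)
    (i : 'I_N) (z : 'cV[R]_(n_ i)) : \bar R :=
  (f i z
   + (rho / 2 * enorm (A i *m z + \sum_(j | j != i) A j *m x j
                       - c - rho^-1 *: lam) ^+ 2)%:E
   + (2^-1 * sqnormM (P i) (z - x i))%:E)%E.

(* No condition is put on x 0 and lam 0: the initial point is arbitrary. *)
Definition is_prox_JADMM (x : nat -> forall i, 'cV[R]_(n_ i))
    (lam : nat -> 'cV[R]_m) : Prop :=
  forall k,
    (forall i, argmin (block_objective (x k) (lam k) i) (x k.+1 i)) /\
    lam k.+1 = lam k - (gamma * rho) *: (\sum_i A i *m x k.+1 i - c).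

Definition Amx : 'M[R]_(m, \sum_i n_ i) := \mxrow_i A i.

Definition Gx : 'M[R]_(\sum_i n_ i) :=
  \mxdiag_i (P i + rho *: ((A i)^T *m A i)).

Definition G'x : 'M[R]_(\sum_i n_ i) := Gx - rho *: (Amx^T *m Amx).

Definition G' : 'M[R]_((\sum_i n_ i) + m) :=
  block_mx G'x 0 0 ((gamma * rho)^-1)%:M.

End ProxJADMM.

Set Implicit Arguments.

Definition xvec (R : realType) (N : nat) (n_ : 'I_N -> nat)
    (x : forall i, 'cV[R]_(n_ i)) : 'cV[R]_(\sum_i n_ i) := \mxcol_i x i.

Definition uvec (R : realType) (N m : nat) (n_ : 'I_N -> nat)
    (x : forall i, 'cV[R]_(n_ i)) (lam : 'cV[R]_m) :
    'cV[R]_((\sum_i n_ i) + m) := col_mx (xvec x) lam.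

(* Main.v *)
Require Import Defs.
From HB Require Import structures.
From mathcomp Require Import all_boot all_order all_algebra.
From mathcomp Require Import all_classical all_reals all_analysis.
From mathcomp Require Import ring lra.
Import Order.TTheory GRing.Theory Num.Theory.
Import numFieldNormedType.Exports.
Local Open Scope classical_set_scope.
Local Open Scope ring_scope.

(** The optimality conditions of the N subproblems stack to
    [A^T (lam^k - dlam^k / gamma) + G'x dx^k \in \partial f (x^{k+1})], where
    [dx^k = x^k - x^{k+1}] and [dlam^k = lam^k - lam^{k+1}].  Monotonicity of
    the subdifferential against the saddle point bounds
    [||u^k - u*||^2 - ||u^{k+1} - u*||^2] (in the [G'] seminorm) from below by
    [||dx^k||^2 + (2 - gamma) / (rho gamma^2) ||dlam^k||^2], so that
    [||u^k - u^{k+1}||^2] is summable.  Monotonicity between two consecutive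
    iterates shows in the same way that this sequence is nonincreasing, and a
    summable nonincreasing nonnegative sequence is o(1/k). *)

Set Implicit Arguments.
Unset Strict Implicit.
Unset Printing Implicit Defensive.

(** * Euclidean inner product, by blocks *)

Section InnerProduct.
Context {R : realType}.

Lemma dotvC n (u v : 'cV[R]_n) : dotv u v = dotv v u.
Proof. by rewrite /dotv !mxE; apply: eq_bigr => i _; rewrite !mxE mulrC. Qed.

Lemma dotvDr n (u v w : 'cV[R]_n) : dotv u (v + w) = dotv u v + dotv u w.
Proof. by rewrite /dotv mulmxDr mxE. Qed.

Lemma dotvZr n (a : R) (u v : 'cV[R]_n) : dotv u (a *: v) = a * dotv u v.
Proof. by rewrite /dotv -scalemxAr mxE. Qed.

Lemma dotvNr n (u v : 'cV[R]_n) : dotv u (- v) = - dotv u v.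
Proof. by rewrite -scaleN1r dotvZr mulN1r. Qed.

Lemma dotvDl n (u v w : 'cV[R]_n) : dotv (u + v) w = dotv u w + dotv v w.
Proof. by rewrite dotvC dotvDr !(dotvC w). Qed.

Lemma dotvZl n (a : R) (u v : 'cV[R]_n) : dotv (a *: u) v = a * dotv u v.
Proof. by rewrite dotvC dotvZr dotvC. Qed.

Lemma dotvNl n (u v : 'cV[R]_n) : dotv (- u) v = - dotv u v.
Proof. by rewrite dotvC dotvNr dotvC. Qed.

Definition dotvE := (dotvDl, dotvDr, dotvZl, dotvZr, dotvNl, dotvNr).

Lemma dotv_trmx m n (M : 'M[R]_(m, n)) u v :
  dotv (M^T *m u) v = dotv u (M *m v).
Proof. by rewrite /dotv trmx_mul trmxK mulmxA. Qed.

Lemma dotv_ge0 n (u : 'cV[R]_n) : 0 <= dotv u u.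
Proof.
by rewrite /dotv mxE; apply: sumr_ge0 => i _; rewrite mxE -expr2 sqr_ge0.
Qed.

Lemma enorm_sqr n (u : 'cV[R]_n) : enorm u ^+ 2 = dotv u u.
Proof. by rewrite sqr_sqrtr // dotv_ge0. Qed.

Lemma sqnormME n (M : 'M[R]_n) z : sqnormM M z = dotv z (M *m z).
Proof. by rewrite /sqnormM /dotv mulmxA. Qed.

Lemma dotv_mxcol N (n_ : 'I_N -> nat) (u v : forall i, 'cV[R]_(n_ i)) :
  dotv (\mxcol_i u i) (\mxcol_i v i) = \sum_i dotv (u i) (v i).
Proof. by rewrite /dotv tr_mxcol mul_mxrow_mxcol summxE. Qed.

(** Turns monotonicity of each block's subdifferential into monotonicity for the separable sum. *)
Lemma dotv_mxcolB_ge0 N (n_ : 'I_N -> nat)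
    (g h u v : forall i, 'cV[R]_(n_ i)) :
    (forall i, 0 <= dotv (g i - h i) (u i - v i)) ->
  0 <= dotv (\mxcol_i g i - \mxcol_i h i) (xvec u - xvec v).
Proof. by move=> gh; rewrite -!mxcolB dotv_mxcol sumr_ge0. Qed.

End InnerProduct.

(** * Subgradients and minimizers *)

Section Subdifferential.
Context {R : realType}.

(** At a point [z] of finite value, the subgradient inequality fails if [f x] is infinite. *)
Lemma subdifferential_fin_num n (f : 'cV[R]_n -> \bar R) x g :
  proper_fun f -> subdifferential f x g -> f x \is a fin_num.
Proof.
move=> [fgt [z fz]] /(_ z) fxz; rewrite fin_numElt fgt /= ltey.
apply/eqP => fxE; move: fxz; rewrite fxE addye //.
by move=> /le_lt_trans /(_ fz); rewrite ltxx.
Qed.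

(** Add the two subgradient inequalities; finiteness lets the values of [f] cancel. *)
Lemma subdifferential_monotone n (f : 'cV[R]_n -> \bar R) x y g h :
    proper_fun f -> subdifferential f x g -> subdifferential f y h ->
  0 <= dotv (g - h) (x - y).
Proof.
move=> fp fxg fyh.
have fxfin := subdifferential_fin_num fp fxg.
have fyfin := subdifferential_fin_num fp fyh.
move: (fxg y) (fyh x); rewrite -(fineK fxfin) -(fineK fyfin) !lee_fin.
by rewrite !dotvE; lra.
Qed.

(* Fermat's rule for [f + q] with [q] quadratic: compare the values at [x] and
   [x + t (y - x)], divide by [t] and let [t] tend to 0. *)
Lemma argmin_subdifferential n (f : 'cV[R]_n -> \bar R) (q Q : 'cV[R]_n -> R)
    x g : proper_fun f -> convex_efun f ->
    (forall d t, q (x + t *: d) = q x + t * dotv g d + t ^+ 2 * Q d) ->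
    argmin (fun z => f z + (q z)%:E)%E x ->
  subdifferential f x (- g).
Proof.
move=> [fgt [z fz]] fconv qE xmin.
have fxfin : f x \is a fin_num.
  rewrite fin_numElt fgt /= ltey; apply/eqP => fxE.
  have := xmin z; rewrite fxE addye // leye_eq => /eqP zE.
  by have := lte_add_pinfty fz (ltry (q z)); rewrite zE ltxx.
move=> y; have [fyfin|] := boolP (f y \is a fin_num); last first.
  by rewrite fin_numElt fgt /= -leNgt leye_eq => /eqP ->; exact: leey.
rewrite -(fineK fxfin) -(fineK fyfin) lee_fin.
set d := y - x; set a := fine (f x); set b := fine (f y).
have key t : 0 < t -> t <= 1 -> a - dotv g d - b <= t * Q d.
  move=> t0 t1.
  have xt : x + t *: d = t *: y + (1 - t) *: x.
    by rewrite /d scalerBr scalerBl scale1r addrCA addrA addrC.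
  have tint : 0 <= t <= 1 by rewrite ltW.
  have := fconv y x t tint; rewrite -xt => fle.
  have := le_trans (xmin (x + t *: d)) (leeD2r _ fle).
  rewrite qE -(fineK fxfin) -(fineK fyfin) -/a -/b !lee_fin => le1.
  by rewrite -(ler_pM2l t0); nra.
rewrite dotvNl; apply/ler_addgt0Pr => e e0.
(* Convexity asks for [t <= 1]; the [+ 1] keeps the denominator positive when [Q d = 0]. *)
set t := Num.min 1 (e / (`|Q d| + 1)).
have Qp : 0 < `|Q d| + 1 by rewrite ltr_wpDl.
have t0 : 0 < t by rewrite lt_min ltr01 divr_gt0.
have t1 : t <= 1 by rewrite ge_min lexx.
have tQ : t * Q d <= e.
  apply: (le_trans (ler_wpM2l (ltW t0) (ler_norm _))).
  have : t <= e / (`|Q d| + 1) by rewrite ge_min lexx orbT.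
  by rewrite ler_pdivlMr //; nra.
by have := key t t0 t1; lra.
Qed.

End Subdifferential.

(** * Rates o(1/k) for real sequences *)

Section LittleO.
Context {R : realType}.

(* If [v k0] exceeds the limit of [v] by at most [d] then, [a] being
   nonincreasing, telescoping gives [(k - k0) a k <= v k0 - v k <= d]. *)
Lemma littleo_inv_of_telescoping (a v : R^nat) :
    (forall k, 0 <= a k) -> (forall k, a k.+2 <= a k.+1) ->
    (forall k, 0 <= v k) -> (forall k, a k <= v k - v k.+1) ->
  a =o_\oo (fun k => k%:R^-1 : R).
Proof.
move=> a0 anincr v0 av.
(* Monotonicity is assumed from index 1 on, so the telescoping starts at [j.+1]. *)
have avS j k : k%:R * a (j.+1 + k)%N <= v j.+1 - v (j.+1 + k)%N.
  elim: k => [|k IH]; first by rewrite mul0r addn0 subrr.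
  have := anincr (j + k)%N; have := av (j.+1 + k)%N; move: IH.
  rewrite addnS !addSn -natr1 => IH av1 a1.
  have : k%:R * a (j + k).+2 <= k%:R * a (j + k).+1 by rewrite ler_wpM2l.
  by lra.
have vnincr : {homo v : i j / (i <= j)%N >-> j <= i}.
  by apply/nonincreasing_seqP => k; have := av k; have := a0 k; lra.
have vcvg : cvgn v.
  by apply: nonincreasing_is_cvgn => //; exists 0 => _ [k _ <-].
apply/eqoP => e e0.
have e20 : 0 < e / 2 by rewrite divr_gt0.
have /cvgrPdist_le /(_ _ e20) [j _ vj] := vcvg.
near=> k.
(* Then [k - j.+1] is at least [k / 2], so the bound [e / 2] on [(k - j.+1) * a k] yields [e] for
   [k * a k]. *)
have jk : (j.+1.*2 <= k)%N by near: k; exact: nbhs_infty_ge.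
have k0 : (0 : R) < k%:R by rewrite ltr0n (leq_trans _ jk).
have jk' : (j.+1 <= k)%N by rewrite (leq_trans _ jk) // -addnn leq_addr.
rewrite ger0_norm // (ger0_norm (x := k%:R^-1)) ?invr_ge0 ?ler0n //.
rewrite ler_pdivlMr //.
have := avS j (k - j.+1)%N; rewrite subnKC // natrB // => le1.
have le2 : 2 * j.+1%:R <= k%:R :> R by rewrite -natrM ler_nat mul2n.
have := nonincreasing_cvgn_ge vnincr vcvg k.
have := vj j.+1 (leqnSn j); rewrite ler_norml => /andP[].
have : 0 <= a k * (k%:R - 2 * j.+1%:R) by rewrite mulr_ge0 // subr_ge0.
by nra.
Unshelve. all: by end_near. Qed.

Lemma littleo_le (C : R) (a b e : R^nat) :
    0 < C -> (forall k, 0 <= b k <= C * a k) ->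
    a =o_\oo e -> b =o_\oo e.
Proof.
move=> C0 bCa /eqoP ao; apply/eqoP => d d0.
have dC0 : 0 < d / C by rewrite divr_gt0.
apply: filterS (ao _ dC0) => k; have /andP[b0 bk] := bCa k.
rewrite (ger0_norm b0) => ak; apply: (le_trans bk).
rewrite -ler_pdivlMl // mulrA [_ * d]mulrC; apply: le_trans ak.
exact: ler_norm.
Qed.

End LittleO.

(** * The energy inequality *)

Section Energy.
Context {R : realType}.

Lemma psdmx_dotvC n (H : 'M[R]_n) p q :
  psdmx H -> dotv p (H *m q) = dotv q (H *m p).
Proof. by move=> [Hsym _]; rewrite -{1}Hsym -dotv_trmx trmxK dotvC. Qed.

(* Both uses of the optimality conditions, against the saddle point and between
   consecutive iterations, are instances with (p, a) the old and (q, b) the new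
   error. *)
Lemma energy_descent m n (M : 'M[R]_(m, n)) (H : 'M[R]_n) gamma rho p q a b :
    psdmx H -> 0 < gamma -> 0 < rho ->
    M *m q = (gamma * rho)^-1 *: (a - b) ->
    0 <= dotv (M^T *m (a - gamma^-1 *: (a - b)) + H *m (p - q)) q ->
  sqnormM H (p - q)
    + (2 - gamma) / gamma * ((gamma * rho)^-1 * dotv (a - b) (a - b))
  <= (sqnormM H p + (gamma * rho)^-1 * dotv a a)
     - (sqnormM H q + (gamma * rho)^-1 * dotv b b).
Proof.
move=> Hpsd gamma0 rho0 Mq.
(* Double the hypothesis and use 2<H(p-q), q> = |p|^2 - |q|^2 - |p-q|^2 in the [H] seminorm and
   2<a-b, a> = |a|^2 - |b|^2 + |a-b|^2. The coefficient of -|a-b|^2 becomes [2 / gamma - 1], up to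
   the factor [s]. *)
rewrite dotvDl dotv_trmx Mq dotvZr (dotvC (H *m _)) !sqnormME.
rewrite !mulmxBr !dotvE (psdmx_dotvC p q Hpsd) (dotvC b a).
set s := (gamma * rho)^-1.
have -> : (2 - gamma) / gamma = 2 * gamma^-1 - 1 by field; rewrite gt_eqF.
nra.
Qed.

Lemma sqnormM_G' N m (n_ : 'I_N -> nat) (A : forall i, 'M[R]_(m, n_ i))
    rho gamma P p b :
  sqnormM (G' A rho gamma P) (col_mx p b) =
  sqnormM (G'x A rho P) p + (gamma * rho)^-1 * dotv b b.
Proof.
rewrite !sqnormME /G' mul_block_col !mul0mx addr0 add0r mul_scalar_mx.
by rewrite {1}/dotv tr_col_mx mul_row_col mxE -!/(dotv _ _) dotvZr.
Qed.

End Energy.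

(** * Optimality conditions of the subproblems *)

Section ProxJADMM.
Unset Implicit Arguments.
Context {R : realType} {N m : nat} {n_ : 'I_N -> nat}.
Context (f : forall i, 'cV[R]_(n_ i) -> \bar R).
Context (A : forall i, 'M[R]_(m, n_ i)) (c : 'cV[R]_m).
Context (rho : R) (P : forall i, 'M[R]_(n_ i)).

Lemma Amx_xvec (x : forall i, 'cV[R]_(n_ i)) :
  Amx A *m xvec x = \sum_i A i *m x i.
Proof. exact: mul_mxrow_mxcol. Qed.

(** Fermat's rule, with the quadratic terms expanded exactly along [z + t *: d]. Their gradient
    contains [rho *: r z], which is [rho *: w - lam]. *)
Lemma block_subgradient (x : forall i, 'cV[R]_(n_ i)) lam i z :
    0 < rho -> psdmx (P i) -> proper_fun (f i) -> convex_efun (f i) ->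
    argmin (block_objective f A c rho P x lam i) z ->
  subdifferential (f i) z
    ((A i)^T *m (lam - rho *: (A i *m z + \sum_(j | j != i) A j *m x j - c))
     + P i *m (x i - z)).
Proof.
move=> rho0 Ppsd fp fc zmin.
set w := A i *m z + \sum_(j | j != i) A j *m x j - c.
pose r y := A i *m y + \sum_(j | j != i) A j *m x j - c - rho^-1 *: lam.
pose q y := rho / 2 * enorm (r y) ^+ 2 + 2^-1 * sqnormM (P i) (y - x i).
pose Q d := rho / 2 * dotv (A i *m d) (A i *m d) + 2^-1 * dotv d (P i *m d).
have -> : (A i)^T *m (lam - rho *: w) + P i *m (x i - z) =
    - ((A i)^T *m (rho *: r z) + P i *m (z - x i)).
  rewrite opprD -!mulmxN opprB; congr (_ *m _ + _).
  by rewrite /r -/w (scalerBr _ w) scalerA divff ?gt_eqF // scale1r opprB.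
apply: (@argmin_subdifferential _ _ _ q Q) => //; last first.
  by move=> y; have := zmin y; rewrite /block_objective /q !EFinD !addeA.
move=> d t; rewrite /q /Q !enorm_sqr !sqnormME.
have -> : r (z + t *: d) = r z + t *: (A i *m d).
  by rewrite /r mulmxDr -scalemxAr -!addrA; congr (_ + _); rewrite addrC !addrA.
have -> : z + t *: d - x i = (z - x i) + t *: d by rewrite addrAC.
move: (r z) (z - x i) => b e; rewrite !mulmxDr -!scalemxAr !dotvE dotv_trmx.
rewrite (psdmx_dotvC e d Ppsd) (dotvC (P i *m e)) (dotvC (A i *m d) b).
by field.
Qed.

(** Block [i] sees the old values of the other blocks. Replacing them by the new ones costs [rho]
    times A_i^T A (x - z), less the block's own term A_i^T A_i (x_i - z_i); together with [P i] this
    stacks to [G'x]. *)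
Lemma mxcol_block_subgradient (x z : forall i, 'cV[R]_(n_ i)) (lam : 'cV[R]_m) :
  \mxcol_i ((A i)^T *m (lam - rho *: (A i *m z i
                                   + \sum_(j | j != i) A j *m x j - c))
            + P i *m (x i - z i)) =
  (Amx A)^T *m (lam - rho *: (Amx A *m xvec z - c))
  + G'x A rho P *m (xvec x - xvec z).
Proof.
have -> : G'x A rho P *m (xvec x - xvec z) =
    \mxcol_i ((P i + rho *: ((A i)^T *m A i)) *m (x i - z i))
    - (Amx A)^T *m (rho *: (Amx A *m xvec x - Amx A *m xvec z)).
  rewrite /G'x mulmxBl -scalemxAl -mulmxA -mulmxBr scalemxAr.
  by congr (_ - _); rewrite -mxcolB; exact: mul_mxdiag_mxcol.
rewrite addrCA -mulmxBr [(Amx A)^T]tr_mxrow mxcol_mul -mxcolD.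
apply: eq_mxcol => i; rewrite mulmxDl -scalemxAl -mulmxA scalemxAr.
rewrite -[RHS]addrA -mulmxDr [LHS]addrC; congr (_ + _ *m _).
rewrite !Amx_xvec [\sum_j A j *m x j](bigD1 i) //= mulmxBr.
by apply/matrixP => j k; rewrite !mxE; ring.
Qed.

End ProxJADMM.

(** * Descent along the iterates and the rate *)

Theorem theorem2p4 (R : realType) (N m : nat) (n_ : 'I_N -> nat)
    (f : forall i, 'cV[R]_(n_ i) -> \bar R)
    (A : forall i, 'M[R]_(m, n_ i)) (c : 'cV[R]_m)
    (rho gamma : R) (P : forall i, 'M[R]_(n_ i)) (eps : 'I_N -> R)
    (x : nat -> forall i, 'cV[R]_(n_ i)) (lam : nat -> 'cV[R]_m)
    (hN : (2 <= N)%N)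
    (hf : forall i, closed_proper_convex (f i))
    (hKKT : exists (xs : forall i, 'cV[R]_(n_ i)) (ls : 'cV[R]_m),
        is_KKT f A c xs ls)
    (hrho : 0 < rho) (hgamma : 0 < gamma)
    (hP : forall i, psdmx (P i))
    (heps : forall i, 0 < eps i)
    (hPA : forall i,
        pdmx (P i - (rho * ((eps i)^-1 - 1)) *: ((A i)^T *m A i)))
    (hsum : \sum_i eps i < 2 - gamma)
    (hG'x : psdmx (G'x A rho P))
    (hADMM : is_prox_JADMM f A c rho gamma P x lam) :
  [/\ (fun k : nat => sqnormM (G' A rho gamma P)
         (uvec (x k) (lam k) - uvec (x k.+1) (lam k.+1)))
        =o_\oo (fun k : nat => k%:R^-1 : R),
      (fun k : nat => sqnormM (G'x A rho P) (xvec (x k) - xvec (x k.+1)))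
        =o_\oo (fun k : nat => k%:R^-1 : R)
    & (fun k : nat => enorm (lam k - lam k.+1) ^+ 2)
        =o_\oo (fun k : nat => k%:R^-1 : R)].
Proof.
have [xs [ls [subs xsc]]] := hKKT.
have gamma2 : 0 < 2 - gamma.
  by rewrite (le_lt_trans _ hsum) // sumr_ge0 // => i _; exact: ltW.
pose X k := xvec (x k); pose Xs := xvec xs; pose M := Amx A.
pose H := G'x A rho P; pose s := (gamma * rho)^-1.
have s0 : 0 < s by rewrite invr_gt0 mulr_gt0.
pose dX k : 'cV[R]__ := X k - X k.+1.
pose dl k : 'cV[R]_m := lam k - lam k.+1.
(* The squared [G'] seminorm of the pair [(p, a)]. *)
pose E p (a : 'cV[R]_m) := sqnormM H p + s * dotv a a.
have E_ge0 p a : 0 <= E p a.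
  by rewrite addr_ge0 ?(mulr_ge0 (ltW s0)) ?dotv_ge0 //; case: hG'x.
(* The multiplier update, solved for the primal residual. *)
have res k : M *m X k.+1 - c = s *: dl k.
  have [_ lamS] := hADMM k; rewrite /dl lamS subKr [M *m _]Amx_xvec scalerA.
  by rewrite mulVf ?scale1r // gt_eqF // mulr_gt0.
pose g k i := (A i)^T *m (lam k - rho *: (A i *m x k.+1 i
    + \sum_(j | j != i) A j *m x k j - c)) + P i *m (x k i - x k.+1 i).
have gsub k i : subdifferential (f i) (x k.+1 i) (g k i).
  have [_ fp fc] := hf i; apply: block_subgradient => //.
  by have [] := hADMM k.
have gE k : \mxcol_i g k i = M^T *m (lam k - gamma^-1 *: dl k) + H *m dX k.
  rewrite mxcol_block_subgradient res scalerA /s invfM mulrC mulfVK //.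
  by rewrite gt_eqF.
have subBB (V : zmodType) (u v w : V) : (u - w) - (v - w) = u - v.
  by rewrite opprB addrA subrK.
(* Errors are taken relative to the saddle point; since [M *m Xs = c], the new error is mapped by
   [M] to the residual. *)
have fejer k : sqnormM H (dX k) + (2 - gamma) / gamma * (s * dotv (dl k) (dl k))
    <= E (X k - Xs) (lam k - ls) - E (X k.+1 - Xs) (lam k.+1 - ls).
  rewrite -[dX k](subBB _ _ _ Xs) -[dl k](subBB _ _ _ ls).
  apply: (@energy_descent _ _ _ M) => //; rewrite !subBB.
    by rewrite mulmxBr [M *m Xs]Amx_xvec xsc res.
  have := @dotv_mxcolB_ge0 _ _ _ (g k) (fun i => (A i)^T *m ls) (x k.+1) xs.
  rewrite gE -mxcol_mul -tr_mxrow addrAC -mulmxBr addrAC; apply => i.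
  by have [_ fp _] := hf i; exact: subdifferential_monotone (gsub k i) (subs i).
(* Here the errors are successive differences, in which [c] cancels; the left side of the energy
   inequality is nonnegative and is dropped. *)
have decr k : E (dX k.+1) (dl k.+1) <= E (dX k) (dl k).
  rewrite -subr_ge0; apply: le_trans (@energy_descent _ _ _ M _ _ _ _ _ _ _
    hG'x hgamma hrho _ _).
  - rewrite addr_ge0 //; first by case: hG'x.
    by rewrite !mulr_ge0 ?dotv_ge0 ?invr_ge0 ?(ltW gamma2) ?mulr_ge0 //;
      exact: ltW.
  - by rewrite mulmxBr -(subBB _ _ _ c) !res -scalerBr.
  have := @dotv_mxcolB_ge0 _ _ _ (g k) (g k.+1) (x k.+1) (x k.+2).
  rewrite !gE opprD addrACA -!mulmxBr.
  have -> : lam k - gamma^-1 *: dl k - (lam k.+1 - gamma^-1 *: dl k.+1) =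
      dl k - gamma^-1 *: (dl k - dl k.+1).
    by apply/matrixP => i j; rewrite !mxE; ring.
  apply => i; have [_ fp _] := hf i.
  exact: subdifferential_monotone (gsub k i) (gsub k.+1 i).
have ok : (fun k => E (dX k) (dl k)) =o_\oo (fun k => k%:R^-1 : R).
  (* The smaller of the two coefficients in [fejer], so that [theta * E (dX k) (dl k)] is below its
     left side. *)
  pose theta := Num.min 1 ((2 - gamma) / gamma).
  have theta0 : 0 < theta by rewrite lt_min ltr01 divr_gt0.
  apply: (@littleo_inv_of_telescoping _ _
    (fun k => theta^-1 * E (X k - Xs) (lam k - ls))) => // k.
    by rewrite mulr_ge0 // invr_ge0 ltW.
  rewrite -mulrBr ler_pdivlMl //; apply: le_trans (fejer k).
  rewrite mulrDr lerD //.
    by rewrite -[leRHS]mul1r ler_wpM2r ?ge_min ?lexx //; case: hG'x.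
  by rewrite ler_wpM2r ?ge_min ?lexx ?orbT // mulr_ge0 ?dotv_ge0 // ltW.
split.
- suff -> : (fun k => sqnormM (G' A rho gamma P)
      (uvec (x k) (lam k) - uvec (x k.+1) (lam k.+1))) =
      (fun k => E (dX k) (dl k)) by [].
  by apply/funext => k; rewrite /uvec opp_col_mx add_col_mx sqnormM_G'.
- apply: littleo_le ltr01 _ ok => k; have [_ ->] := hG'x.
  by rewrite mul1r lerDl mulr_ge0 ?dotv_ge0 // ltW.
(* The constant is the inverse of the weight [s] of the multiplier part in [E]. *)
- apply: (@littleo_le _ (gamma * rho)) ok => [|k]; first exact: mulr_gt0.
  rewrite enorm_sqr dotv_ge0 -ler_pdivrMl ?mulr_gt0 // lerDr.
  by case: hG'x => _ ->.
Qed.
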